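(* The threshold bias $b_0(n)$ for the connectivity game $\mathcal{C}(E_b,n)$ satisfies $b_0(n)>0.1n$; i.e. Maker (with Breaker moving first) has a winning strategy whenever $b\le 0.1n$.
   Context: $\mathcal{C}(E_b,n)$ is the following game on the edge set of $K_n$ ($n$ large): players alternate; on each turn Maker claims one unclaimed edge, and Breaker claims a set of at most $b$ pairwise vertex-disjoint unclaimed edges. The game ends when no unclaimed edges remain. Maker wins if her graph contains a spanning tree of $K_n$; otherwise Breaker wins. The threshold bias is the value $b_0(n)$ such that Breaker wins if $b>b_0$ and Maker wins if $b\le b_0$. In considering Maker strategies, Breaker makes the first move. *)

(* Defs.v *)
From HB Require Import structures.
From mathcomp Require Import all_boot.

Set Implicit Arguments.
Unset Strict Implicit.
Unset Printing Implicit Defensive.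

Section Graphs.
Variable n : nat.

Definition edge := {set 'I_n}.

Definition Kn_edges : {set edge} := [set e : {set 'I_n} | #|e| == 2].

Definition adj (G : {set edge}) : rel 'I_n := [rel x y | [set x; y] \in G].

(* A closed walk x, y, x along a single edge is a [ucycle] of size 2, so
   graph-theoretic cycles are exactly the [ucycle]s of size at least 3. *)
Definition acyclic (G : {set edge}) : Prop :=
  forall c : seq 'I_n, ucycle (adj G) c -> size c <= 2.

Definition is_spanning_tree (T : {set edge}) : Prop :=
  [/\ T \subset Kn_edges, (forall x y, connect (adj T) x y) & acyclic T].

End Graphs.

Inductive player := Maker | Breaker.

Definition is_maker (p : player) : bool := if p is Maker then true else false.
Definition player_of_bool (m : bool) : player := if m then Maker else Breaker.
Lemma is_makerK : cancel is_maker player_of_bool.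
Proof. by case. Qed.
HB.instance Definition _ := Equality.copy player (can_type is_makerK).

Section Game.
Variables n b : nat.

(* A move is the set of edges claimed during one turn (a singleton for Maker);
   a history lists the moves made so far, the most recent one first. *)
Definition move := {set edge n}.
Definition history := seq move.

(* Breaker makes the first move. *)
Definition to_move (h : history) : player :=
  if odd (size h) then Maker else Breaker.

Fixpoint claimed (p : player) (h : history) : {set edge n} :=
  if h is m :: h' then
    if to_move h' == p then m :|: claimed p h' else claimed p h'
  else set0.

Definition unclaimed (h : history) : {set edge n} :=
  Kn_edges n :\: (claimed Maker h :|: claimed Breaker h).

Definition finished (h : history) : bool := unclaimed h == set0.

(* [trivIset m]: the edges in [m] are pairwise vertex-disjoint. *)
Definition legal_move (h : history) (m : move) : bool :=
  (m \subset unclaimed h) &&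
  match to_move h with
  | Maker => #|m| == 1
  | Breaker => (#|m| <= b) && trivIset m
  end.

Fixpoint legal_play (h : history) : bool :=
  if h is m :: h' then [&& legal_play h', ~~ finished h' & legal_move h' m]
  else true.

Definition strategy := history -> move.

Fixpoint follows (p : player) (s : strategy) (h : history) : Prop :=
  if h is m :: h' then (to_move h' = p -> m = s h') /\ follows p s h'
  else True.

Definition maker_won (h : history) : Prop :=
  exists2 T : {set edge n}, T \subset claimed Maker h & is_spanning_tree T.

Definition won (p : player) (h : history) : Prop :=
  match p with Maker => maker_won h | Breaker => ~ maker_won h end.

(* Maker claims an edge at each of her turns, so every play is finite and it
   suffices to look at the finished plays. *)
Definition winning_strategy (p : player) (s : strategy) : Prop :=
  forall h, legal_play h -> follows p s h ->
    [/\ ~~ finished h -> to_move h = p -> legal_move h (s h)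
      & finished h -> won p h].

Definition has_winning_strategy (p : player) : Prop :=
  exists s : strategy, winning_strategy p s.

End Game.

Definition is_threshold_bias (n b0 : nat) : Prop :=
  forall b, (b <= b0 -> has_winning_strategy n b Maker) /\
            (b0 < b -> has_winning_strategy n b Breaker).

(* Main.v *)
Require Import Defs.
From mathcomp Require Import all_boot.
From mathcomp Require Import zify.

Set Implicit Arguments.
Unset Strict Implicit.
Unset Printing Implicit Defensive.

(* Maker wins as soon as [8 * b <= n].  She keeps a set [A] of active vertices
   meeting every component of her graph; on each turn she takes the active
   vertex [v] of largest Breaker degree, claims any free edge leaving the
   component of [v], and drops [v] from [A].  A Breaker move is a matching, so it
   raises the average Breaker degree of [j] vertices by at most
   [min 1 (2 * b / j)], while dropping the maximum bounds averages over [j]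
   vertices by averages over [j + 1]; hence active degrees never exceed
   [3 * n / 4].  If no free edge left a component with [c] vertices, then the
   degrees of the active vertices inside and outside it would force
   [n / 4 <= c <= 3 * n / 4], and Breaker would own [c * (n - c) >= 3 * n^2 / 16]
   edges, more than the [b * (n - 1) < n^2 / 8] he can have claimed. *)

(** * Spanning trees of connected graphs *)

Section SpanningTree.
Variable n : nat.
Implicit Types (G T : {set edge n}) (x y z : 'I_n).

Lemma adj_sym G : symmetric (adj G).
Proof. by move=> x y; rewrite /adj /= setUC. Qed.

Lemma adj_connect_sym G : connect_sym (adj G).
Proof. exact/sym_connect_sym/adj_sym. Qed.

Lemma connect_adjS G G' x y :
  G \subset G' -> connect (adj G) x y -> connect (adj G') x y.
Proof.
move=> /subsetP sGG'; apply: connect_sub => u w Guw; apply: connect1.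
exact: sGG'.
Qed.

Definition connected_graph G : bool :=
  [forall x, forall y, connect (adj G) x y].

Lemma connected_graphP G :
  reflect (forall x y, connect (adj G) x y) (connected_graph G).
Proof. by apply: (iffP forallP) => H x; apply/forallP/H. Qed.

Lemma connected_graphS G G' :
  G \subset G' -> connected_graph G -> connected_graph G'.
Proof.
move=> sG /connected_graphP cG; apply/connected_graphP => x y.
exact: connect_adjS sG (cG x y).
Qed.

(** An edge of a cycle can be deleted without disconnecting the graph, since the rest of the cycle
    still joins its ends. *)
Lemma minimal_connected_acyclic T :
  minset connected_graph T -> acyclic T.
Proof.
move=> /minsetP [/connected_graphP cT minT] [|x [|y [|z c]]] // /andP [].
rewrite /cycle rcons_path [path _ _ _]/= => /andP [/and3P [Txy Tyz pzc] Tlx].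
rewrite [uniq _]/= !inE !negb_or -!andbA.
case/and5P => xy xz xc yz /and3P [yc zc uc].
pose e : edge n := [set x; y].
have conn_xy : connect (adj (T :\ e)) x y.
  rewrite adj_connect_sym; apply: (@connect_trans _ _ z).
    apply: connect1; rewrite /adj /= in_setD1 (Tyz : _ \in T) andbT.
    by apply/eqP => /setP /(_ x); rewrite !inE eqxx (negbTE xy) (negbTE xz).
  apply/connectP; exists (rcons c x); last by rewrite last_rcons.
  (* From [z] through [c] to [x] the walk avoids [y], so it never uses [e]. *)
  apply: (@sub_in_path _ [pred u | u != y] (adj T)).
  - move=> u w; rewrite !inE => uy wy Tuw; rewrite /adj /= in_setD1 (Tuw : _ \in T) andbT.
    apply/eqP => /setP /(_ y); rewrite !inE eqxx orbT.
    by rewrite eq_sym (negbTE uy) eq_sym (negbTE wy).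
  - rewrite /= eq_sym yz all_rcons /= xy; apply/allP => u uc' /=.
    by apply: contraNneq yc => <-.
  - by rewrite rcons_path pzc.
suff /(minT _) /(_ (subD1set _ _)) /setP /(_ e) : connected_graph (T :\ e).
  by rewrite in_setD1 eqxx (Txy : _ \in T).
apply/connected_graphP => u w; apply: connect_sub (cT u w) => u' w' Tuw.
have [euw|neuw] := eqVneq [set u'; w'] e; last first.
  by apply: connect1; rewrite /adj /= in_setD1 neuw.
have : u' \in e by rewrite -euw !inE eqxx.
have : w' \in e by rewrite -euw !inE eqxx orbT.
by rewrite !inE => /orP [] /eqP -> /orP [] /eqP ->; rewrite ?connect0 // adj_connect_sym.
Qed.

Lemma connected_spanning_tree G :
  G \subset Kn_edges n -> connected_graph G ->
  exists2 T : {set edge n}, T \subset G & is_spanning_tree T.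
Proof.
move=> sGK cG; have [T minT sTG] := minset_exists cG.
exists T => //; split; first exact: subset_trans sTG sGK.
  exact/connected_graphP/minsetp/minT.
exact: minimal_connected_acyclic.
Qed.

End SpanningTree.

(** * Degrees, cuts and matchings *)

Section Degree.
Variable n : nat.
Implicit Types (B m : {set edge n}) (S C : {set 'I_n}) (x y z : 'I_n).

Definition degree B x : nat := #|[set e in B | x \in e]|.

Lemma degreeU B B' x : degree (B :|: B') x <= degree B x + degree B' x.
Proof.
rewrite /degree; apply: leq_trans (leq_card_setU _ _).
by apply/subset_leq_card/subsetP => e; rewrite !inE andb_orl.
Qed.

Lemma degree_ge B x C :
  (forall y, y \in C -> [set x; y] \in B) -> x \notin C -> #|C| <= degree B x.
Proof.
move=> BC xC; rewrite -(@card_in_imset _ _ (fun y => [set x; y])).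
  apply/subset_leq_card/subsetP => _ /imsetP [y yC ->].
  by rewrite !inE eqxx BC.
move=> y z yC zC /setP /(_ y); rewrite !inE eqxx orbT.
by case/esym/orP => /eqP // yx; rewrite -yx yC in xC.
Qed.

Lemma cut_card_le B C :
  (forall x y, x \in C -> y \notin C -> [set x; y] \in B) ->
  #|C| * #|~: C| <= #|B|.
Proof.
move=> BC; rewrite -cardsX.
rewrite -(@card_in_imset _ _ (fun p : 'I_n * 'I_n => [set p.1; p.2])).
  apply/subset_leq_card/subsetP => _ /imsetP [[x y] + ->].
  by rewrite !inE => /andP [/= xC yC]; apply: BC.
move=> [x y] [x' y']; rewrite !inE /= => /andP [xC yC] /andP [x'C y'C] e.
have : x \in [set x'; y'] by rewrite -e !inE eqxx.
have : y \in [set x'; y'] by rewrite -e !inE eqxx orbT.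
rewrite !inE => /orP [/eqP yx'|/eqP ->]; first by rewrite yx' x'C in yC.
by case/orP => [/eqP -> //|/eqP xy']; rewrite -xy' xC in y'C.
Qed.

Lemma degree_matching m x : trivIset m -> degree m x <= 1.
Proof.
move=> /trivIsetP triv; rewrite leqNgt; apply/negP => /card_gt1P [e [e']].
rewrite !inE => - [/andP [em xe] /andP [e'm xe']] /(triv _ _ em e'm).
by rewrite -setI_eq0 => /eqP /setP /(_ x); rewrite !inE xe xe'.
Qed.

(** Double counting of the incidences between vertices and edges. *)
Lemma sum_degree m : m \subset Kn_edges n -> \sum_x degree m x = 2 * #|m|.
Proof.
move=> /subsetP mK.
under eq_bigr => x _ do rewrite /degree -sum1dep_card.
rewrite (exchange_big_dep (mem m)) /=; last by move=> x e _ /andP [].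
rewrite mulnC -sum_nat_const; apply: eq_bigr => e em.
rewrite em /= sum1dep_card.
by have := mK e em; rewrite inE => /eqP <-; apply: eq_card => x; rewrite !inE.
Qed.

End Degree.

(** * Plays and strategies *)

Section Game.
Variables n b : nat.
Implicit Types (h : history n) (m : move n) (s : strategy n).

Lemma claimed_Kn p h : legal_play b h -> claimed p h \subset Kn_edges n.
Proof.
elim: h => [|m h IH] /=; first by rewrite sub0set.
move=> /and3P [/IH sK _ /andP [mU _]].
case: ifP => // _; rewrite subUset sK andbT.
exact: subset_trans mU (subsetDl _ _).
Qed.

Lemma to_move_cons m h :
  to_move (m :: h) = if to_move h is Maker then Breaker else Maker.
Proof. by rewrite /to_move /=; case: odd. Qed.

Lemma unclaimed_cons m h : unclaimed (m :: h) = unclaimed h :\: m.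
Proof.
apply/setP => e; rewrite /unclaimed /= /to_move.
by case: odd => /=; rewrite !inE; case: (e \in m); rewrite ?orbT ?andbT ?andbF.
Qed.

(* A boolean invariant that Maker can always restore yields a strategy that
   depends on the history only: play any move restoring it. *)
Lemma invariant_winning_strategy (P : pred (history n)) :
  P [::] ->
  (forall h m, legal_play b h -> P h -> to_move h = Breaker ->
     legal_move b h m -> P (m :: h)) ->
  (forall h, legal_play b h -> P h -> to_move h = Maker -> ~~ finished h ->
     exists2 m, legal_move b h m & P (m :: h)) ->
  (forall h, legal_play b h -> P h -> finished h -> maker_won h) ->
  has_winning_strategy n b Maker.
Proof.
move=> P0 PB PM Pwon.
pose s h := odflt set0 [pick m | legal_move b h m && P (m :: h)].
have sP h : legal_play b h -> P h -> to_move h = Maker -> ~~ finished h ->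
    legal_move b h (s h) && P (s h :: h).
  move=> lh Ph tm fin; rewrite /s; case: pickP => //= none.
  by have [m lm Pm] := PM h lh Ph tm fin; have := none m; rewrite lm Pm.
exists s => h lh fh.
have Ph : P h.
  elim: h lh fh => [|m h IH] //= /and3P [lh fin lm] [ms fh].
  have Ph := IH lh fh; case tm : (to_move h); last exact: PB.
  by rewrite (ms tm); case/andP: (sP h lh Ph tm fin).
split; last exact: Pwon.
by move=> fin tm; case/andP: (sP h lh Ph tm fin).
Qed.

(** Played against each other, the two strategies yield a finished play both won and not won by
    Maker. *)
Lemma not_both_win :
  has_winning_strategy n b Maker -> has_winning_strategy n b Breaker -> False.
Proof.
move=> [s ws] [t wt].
suff [h [lh fs ft fin]] : exists h, [/\ legal_play b h, follows Maker s h,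
    follows Breaker t h & finished h].
  by have [_ /(_ fin)] := ws h lh fs; have [_ /(_ fin)] := wt h lh ft.
have step h : legal_play b h -> follows Maker s h -> follows Breaker t h ->
    ~~ finished h -> exists m, [/\ legal_play b (m :: h),
    follows Maker s (m :: h), follows Breaker t (m :: h) & legal_move b h m].
  move=> lh fs ft fin; have [/(_ fin) ls _] := ws h lh fs.
  have [/(_ fin) lt _] := wt h lh ft.
  case tm : (to_move h).
    by exists (s h); split; rewrite /= ?lh ?fin ?tm //=; apply: ls.
  by exists (t h); split; rewrite /= ?lh ?fin ?tm //=; apply: lt.
(* Breaker may pass, so the decreasing measure also counts whose turn it is. *)
pose mu h := 2 * #|unclaimed h| + ~~ odd (size h).
suff play k h : mu h < k -> legal_play b h -> follows Maker s h ->
    follows Breaker t h -> exists h, [/\ legal_play b h, follows Maker s h,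
    follows Breaker t h & finished h].
  exact: (play _ [::] (ltnSn _)).
elim: k h => // k IH h mk lh fs ft.
have [fin|fin] := boolP (finished h); first by exists h.
have [m [lm fs' ft' leg]] := step h lh fs ft fin.
apply: (IH (m :: h)) => //.
suff mu_lt : mu (m :: h) < mu h by apply: leq_trans mu_lt _.
move: leg; rewrite /mu unclaimed_cons /legal_move /to_move /= negbK.
case: odd => /= /andP [sub cm].
  (* The factor 2 in [mu] absorbs the turn flag, which goes from 0 to 1 on Maker's move. *)
  have lt_arith p q : p < q -> 2 * p + true < 2 * q + false by lia.
  apply/lt_arith/proper_card; have /cards1P [e me] := cm.
  rewrite me in sub *; apply/properP; split; first exact: subsetDl.
  by exists e; [rewrite -sub1set | rewrite !inE eqxx].
have le_arith p q : p <= q -> 2 * p + false < 2 * q + true by lia.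
exact/le_arith/subset_leq_card/subsetDl.
Qed.

End Game.

(** * Maker's strategy for [8 * b <= n] *)

Section MakerStrategy.
Variables n b : nat.
Hypothesis n_gt0 : 0 < n.
Hypothesis b_le : 8 * b <= n.
Implicit Types (h : history n) (m : move n) (G B : {set edge n}).
Implicit Types (A S C : {set 'I_n}) (x y z v a : 'I_n).

Definition covers G A : bool := [forall x, exists a in A, connect (adj G) x a].

Lemma coversP G A :
  reflect (forall x, exists2 a, a \in A & connect (adj G) x a) (covers G A).
Proof. by apply: (iffP forallP) => H x; apply/exists_inP/H. Qed.

(** Otherwise Breaker owns the whole cut around the component of [v]: then [v] is joined to
    everything outside and some active [a] outside to everything inside, so the degree bound limits
    both sides. *)
Lemma free_edge G B A v :
  covers G A -> ~~ connected_graph G -> #|B| <= b * n.-1 ->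
  (forall a, a \in A -> 4 * degree B a <= 3 * n) -> v \in A ->
  exists x y, [/\ connect (adj G) v x, ~~ connect (adj G) v y &
                  [set x; y] \notin G :|: B].
Proof.
move=> /coversP covA ncG cB degA vA; pose C := [set x | connect (adj G) v x].
have [/existsP [x /existsP [y /and3P [vx vy fxy]]]|] :=
  boolP [exists x, exists y, [&& connect (adj G) v x, ~~ connect (adj G) v y &
                  [set x; y] \notin G :|: B]]; first by exists x, y.
move=> /existsPn none.
have BC x y : x \in C -> y \notin C -> [set x; y] \in B.
  rewrite !inE => vx vy; have /existsPn /(_ y) := none x.
  rewrite vx vy negbK inE => /orP [Gxy|//].
  by case/negP: vy; apply: connect_trans vx (connect1 Gxy).
have vC : v \in C by rewrite inE.
have [y yC] : exists y, y \notin C.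
  apply/existsP; apply: contraNT ncG => /existsPn CT.
  have vT x : connect (adj G) v x by have := CT x; rewrite negbK inE.
  apply/connected_graphP => x y; apply: connect_trans (vT y).
  by rewrite adj_connect_sym.
have [a aA ya] := covA y.
have aC : a \notin C.
  rewrite inE; apply: contra yC => va; rewrite inE.
  by apply: connect_trans va _; rewrite adj_connect_sym.
have dv : #|~: C| <= degree B v.
  by apply: degree_ge => [z|]; rewrite in_setC ?vC // => zC; apply: BC.
have da : #|C| <= degree B a.
  by apply: degree_ge => // z zC; rewrite setUC; apply: BC.
have := cut_card_le BC; have := degA v vA; have := degA a aA.
have := cardsC C; rewrite card_ord.
move: #|C| #|~: C| dv da => p q dv da pq d1 d2 cut.
(* As [p + q = n], [h1] and [h2] give [16 * (p * q) >= 3 * n ^ 2], against [h3]. *)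
have h1 : 4 * p <= 3 * n by lia.
have h2 : 4 * q <= 3 * n by lia.
have h3 : 8 * (p * q) <= n * n.-1 by nia.
exfalso; nia.
Qed.

(* With [w i] the bound on how much one Breaker move raises the average Breaker
   degree of [i] vertices, [w i = 1] for [i < n / 2] and [w i = 1 / 2] for
   [n / 2 <= i], this is [2 * \sum_(j <= i <= n) w i]. *)
Definition avg_bound j : nat := (n.+1 - j) + (uphalf n - j).

(** The offset [j0] is 1 when Breaker is to move and 0 when Maker is: his move adds the increment
    [w j] to the bound for [j] vertices. *)
Definition balanced B A j0 : bool :=
  [forall S : {set 'I_n}, (S \subset A) ==>
     (2 * \sum_(x in S) degree B x <= #|S| * avg_bound (#|S| + j0))].

Lemma balancedP B A j0 :
  reflect (forall S, S \subset A ->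
     2 * \sum_(x in S) degree B x <= #|S| * avg_bound (#|S| + j0))
    (balanced B A j0).
Proof.
apply: (iffP forallP) => H S; first by move=> SA; have := H S; rewrite SA.
exact/implyP/H.
Qed.

Lemma balanced_breaker B A m :
  m \subset Kn_edges n -> #|m| <= b -> trivIset m ->
  balanced B A 1 -> balanced (m :|: B) A 0.
Proof.
move=> mK mb triv /balancedP bal; apply/balancedP => S SA.
have inc : \sum_(x in S) degree (m :|: B) x <=
    \sum_(x in S) degree m x + \sum_(x in S) degree B x.
  by rewrite -big_split; apply: leq_sum => x _; apply: degreeU.
have inc1 : \sum_(x in S) degree m x <= #|S|.
  by rewrite -sum1_card; apply: leq_sum => x _; apply: degree_matching.
have inc2 : \sum_(x in S) degree m x <= 2 * b.
  apply: (@leq_trans (2 * #|m|)); last by rewrite leq_mul2l.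
  by rewrite -sum_degree // [X in _ <= X](bigID (mem S)) /= leq_addr.
have := bal S SA; have : #|S| <= n by rewrite -[X in _ <= X]card_ord max_card.
move: inc inc1 inc2; rewrite /avg_bound addn0 addn1.
move: (\sum_(x in S) _) (\sum_(x in S) _) (\sum_(x in S) _) #|S|.
move=> d' dm d j h1 h2 h3 jn h4.
(* Below [n / 2] the matching bound [dm <= j] suffices; from there on,
   [2 * dm <= 4 * b <= n / 2 <= j]. *)
have [jl|jl] := ltnP j (uphalf n).
  have -> : n.+1 - j + (uphalf n - j) = n.+1 - j.+1 + (uphalf n - j.+1) + 2.
    by lia.
  by rewrite mulnDr; lia.
have -> : n.+1 - j + (uphalf n - j) = n.+1 - j.+1 + (uphalf n - j.+1) + 1.
  by lia.
rewrite mulnDr; lia.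
Qed.

(* Deleting the vertex of largest degree does not raise the average over any
   set of remaining vertices beyond that of the set with the vertex added. *)
Lemma balanced_maker B A v :
  v \in A -> (forall a, a \in A -> degree B a <= degree B v) ->
  balanced B A 0 -> balanced B (A :\ v) 1.
Proof.
move=> vA vmax /balancedP bal; apply/balancedP => S.
rewrite subsetD1 => /andP [SA vS].
have := bal (v |: S); rewrite subUset sub1set vA SA => /(_ isT).
rewrite big_setU1 //= cardsU1 vS addn0 add1n addn1.
have : \sum_(x in S) degree B x <= #|S| * degree B v.
  by rewrite -sum_nat_const; apply: leq_sum => x xS; apply/vmax/(subsetP SA).
move: (\sum_(x in S) _) #|S| (degree B v) (avg_bound _) => d j dv H h1 h2.
(* The key inequality is [(j + 1) * d <= j * (d + dv)]. *)
rewrite -(leq_pmul2l (ltn0Sn j)); nia.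
Qed.

(** The case of one vertex: [avg_bound 1] is at most [3 * n / 2], and [avg_bound] is decreasing. *)
Lemma balanced_degree B A j0 a :
  balanced B A j0 -> a \in A -> 4 * degree B a <= 3 * n.
Proof.
move=> /balancedP /(_ [set a]); rewrite sub1set => + aA => /(_ aA).
rewrite big_set1 cards1 /avg_bound; lia.
Qed.

(** As Breaker starts, [(size h)./2] counts Maker's turns, each of which drops one vertex from [A],
    and [uphalf (size h)] counts Breaker's. Once Maker's graph is connected, nothing more is
    tracked. *)
Definition maker_inv h : bool :=
  connected_graph (claimed Maker h) ||
  [exists A : {set 'I_n},
    [&& covers (claimed Maker h) A, #|A| + (size h)./2 == n,
        #|claimed Breaker h| <= b * uphalf (size h) &
        balanced (claimed Breaker h) A (~~ odd (size h))]].


Lemma covers_card_gt1 G A : covers G A -> ~~ connected_graph G -> 1 < #|A|.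
Proof.
move=> /coversP covA; rewrite ltnNge; apply: contra => /card_le1P A1.
apply/connected_graphP => x y.
have [a aA xa] := covA x; have [a' a'A ya'] := covA y.
move: a'A; rewrite (A1 a aA) inE => /eqP ea; rewrite ea in ya'.
by apply: connect_trans xa _; rewrite adj_connect_sym.
Qed.

Lemma maker_inv_free_edge h A v :
  covers (claimed Maker h) A -> #|A| + (size h)./2 = n ->
  #|claimed Breaker h| <= b * uphalf (size h) ->
  balanced (claimed Breaker h) A (~~ odd (size h)) ->
  ~~ connected_graph (claimed Maker h) -> v \in A ->
  exists x y, [/\ connect (adj (claimed Maker h)) v x,
    ~~ connect (adj (claimed Maker h)) v y & [set x; y] \in unclaimed h].
Proof.
move=> cov cA cB bal nc vA; have A2 := covers_card_gt1 cov nc.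
(* Since [A] keeps two vertices, Maker has had at most [n - 2] turns and Breaker at most [n - 1]. *)
have cB' : #|claimed Breaker h| <= b * n.-1.
  by apply: leq_trans cB _; rewrite leq_mul2l; apply/orP; right; lia.
have [x [y [vx vy xy]]] := free_edge cov nc cB' (fun a => balanced_degree (a := a) bal) vA.
have xNy : x != y by apply: contraNneq vy => <-.
by exists x, y; split; rewrite // /unclaimed in_setD xy inE cards2 xNy.
Qed.

Lemma maker_inv_breaker h m :
  maker_inv h -> to_move h = Breaker -> legal_move b h m -> maker_inv (m :: h).
Proof.
rewrite /maker_inv /legal_move /= => inv tm; rewrite tm eqxx.
have {}tm : ~~ odd (size h) by move: tm; rewrite /to_move; case: odd.
rewrite (_ : (Breaker == Maker) = false) // => /and3P [mU mb triv].
case/orP: inv => [-> //|/existsP [A /and4P [cov /eqP cA cB bal]]].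
apply/orP; right; apply/existsP; exists A.
rewrite cov uphalf_half (negbTE tm) cA eqxx /=; apply/andP; split.
  apply: leq_trans (leq_card_setU _ _) _.
  by rewrite uphalf_half (negbTE tm) in cB; rewrite mulnS leq_add.
rewrite tm in bal; apply: balanced_breaker => //.
exact: subset_trans mU (subsetDl _ _).
Qed.

Lemma maker_inv_maker h :
  maker_inv h -> to_move h = Maker -> ~~ finished h ->
  exists2 m, legal_move b h m & maker_inv (m :: h).
Proof.
rewrite /maker_inv /legal_move /= => inv tm fin; rewrite tm eqxx.
have {tm} oh : odd (size h) by move: tm; rewrite /to_move; case: odd.
have [cG|nc] := boolP (connected_graph (claimed Maker h)).
  case/set0Pn: fin => e eU; exists [set e]; rewrite ?sub1set ?eU ?cards1 //.
  by rewrite (connected_graphS (subsetUr _ _) cG).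
rewrite (negbTE nc) /= in inv.
case/existsP: inv => A /and4P [cov /eqP cA cB bal].
have A2 := covers_card_gt1 cov nc.
have [a0 a0A] : exists a0, a0 \in A by apply/card_gt0P/ltnW.
case: (arg_maxnP (degree (claimed Breaker h)) a0A) => v vA vmax.
have [x [y [vx vy xyU]]] := maker_inv_free_edge cov cA cB bal nc vA.
exists [set [set x; y]]; first by rewrite sub1set xyU cards1.
apply/orP; right; apply/existsP; exists (A :\ v).
rewrite oh /= in bal *; apply/and4P; split.
- set G := claimed Maker h in cov nc vx vy *; apply/coversP => z.
  have sG : G \subset [set [set x; y]] :|: G := subsetUr _ _.
  move/coversP: cov => cov; have [a' a'A za'] := cov z.
  have [ea'|na'] := eqVneq a' v; last first.
    by exists a'; rewrite ?in_setD1 ?na' //; apply: connect_adjS za'.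
  (* A vertex [z] that was represented by [v] now reaches [a] through the new edge; [a] differs from
     [v] because [y] lies outside the component of [v]. *)
  have [a aA ya] := cov y; exists a.
    rewrite in_setD1 aA andbT; apply: contraNneq vy => <-.
    by rewrite adj_connect_sym.
  rewrite ea' in za'.
  apply: (connect_trans (connect_adjS sG (connect_trans za' vx))).
  apply: connect_trans (connect_adjS sG ya); apply: connect1.
  by rewrite /adj /= !inE eqxx.
- rewrite (cardsD1 v A) (vA : v \in A) in cA.
  by apply/eqP; rewrite uphalf_half oh addnCA addnA.
- by rewrite uphalf_half oh in cB.
- exact: balanced_maker.
Qed.

(** If Maker's graph were disconnected, the invariant would still provide a free edge. *)
Lemma maker_inv_won h :
  legal_play b h -> maker_inv h -> finished h -> maker_won h.
Proof.
move=> lh inv /eqP fin; apply: connected_spanning_tree.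
  exact: claimed_Kn lh.
apply: contraT => nc; move: inv; rewrite /maker_inv (negbTE nc) /=.
case/existsP=> A /and4P [cov /eqP cA cB bal].
have [v vA] : exists v, v \in A.
  exact/card_gt0P/ltnW/(covers_card_gt1 cov).
have [x [y [_ _]]] := maker_inv_free_edge cov cA cB bal nc vA.
by rewrite fin inE.
Qed.

Lemma maker_inv_nil : maker_inv [::].
Proof.
apply/orP; right; apply/existsP; exists setT; apply/and4P; split.
- by apply/coversP => x; exists x.
- by rewrite cardsT card_ord addn0.
- by rewrite cards0.
- apply/balancedP => S _; rewrite big1 ?muln0 // => x _.
  by apply/eqP; rewrite cards_eq0; apply/eqP/setP => e; rewrite !inE.
Qed.

Lemma maker_wins : has_winning_strategy n b Maker.
Proof.
apply: (invariant_winning_strategy maker_inv_nil).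
- by move=> h m _; apply: maker_inv_breaker.
- by move=> h _; apply: maker_inv_maker.
- exact: maker_inv_won.
Qed.

End MakerStrategy.

Theorem theorem4p3 :
  exists n0 : nat, forall n : nat, n0 <= n ->
    (forall b0 : nat, is_threshold_bias n b0 -> n < 10 * b0) /\
    (forall b : nat, 10 * b <= n -> has_winning_strategy n b Maker).
Proof.
(* With [n >= 40], [10 * b0 <= n] gives [8 * (b0 + 1) <= n], so Maker would also win at bias
   [b0 + 1]. *)
exists 40 => n n40; split=> [b0 thr|b bn]; last by apply: maker_wins; lia.
rewrite ltnNge; apply/negP => b0n.
apply: (@not_both_win n b0.+1); first by apply: maker_wins; lia.
by have [_ /(_ (ltnSn b0))] := thr b0.+1.
Qed.
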